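(* Let $\Sigma=(X,\mathcal{D},\phi)$ be a forward complete system with equilibrium point $0$. Assume that $V:X\to\mathbb{R}_+$ is a non-coercive Lyapunov function for $\Sigma$ with corresponding functions $\alpha\in\mathcal{K}$ and $\psi_2\in\mathcal{K}_\infty$. Then: (i) The following statements hold: (i-a) $0$ is iUGS with this $\alpha$ and with $\psi:=\psi_2$; (i-b) $0$ is iUGATT with this $\alpha$; (i-c) $0$ is iUGAS. (ii) If additionally $0$ is a REP, then $0$ is UGATT and UAS. (iii) If additionally $0$ is a REP and $\Sigma$ is RFC, then $0$ is UGAS.
   Context: Notation: $\mathbb{R}_+=[0,\infty)$; $B_r=\{x\in X: \|x\|_X<r\}$, $\overline{B_r}$ is its closure. Comparison functions: $\mathcal{K}$ is the set of continuous strictly increasing $\gamma:\mathbb{R}_+\to\mathbb{R}_+$ with $\gamma(0)=0$; $\mathcal{K}_\infty$ is the set of unbounded $\gamma\in\mathcal{K}$; $\mathcal{KL}$ is the set of continuous $\beta:\mathbb{R}_+^2\to\mathbb{R}_+$ such that $\beta(\cdot,t)\in\mathcal{K}$ for all $t\ge0$ and $\beta(r,\cdot)$ is decreasing to $0$ for all $r>0$. A forward complete system $\Sigma=(X,\mathcal{D},\phi)$ consists of a normed linear space $(X,\|\cdot\|_X)$; a set $\mathcal{D}$ of functions $d:\mathbb{R}_+\to D$ (disturbances), where $D$ is a nonempty subset of a normed linear space; and a map $\phi:\mathbb{R}_+\times X\times\mathcal{D}\to X$ (everywhere defined), such that: - shift invariance: for all $d\in\mathcal{D}$, $\tau\ge0$,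 $d(\cdot+\tau)\in\mathcal{D}$; - concatenation: for all $d_1,d_2\in\mathcal{D}$ and $t>0$ the function equal to $d_1(\tau)$ for $\tau\in[0,t]$ and to $d_2(\tau-t)$ for $\tau>t$ is in $\mathcal{D}$; - identity: $\phi(0,x,d)=x$ for all $(x,d)$; - causality: if $d(s)=\tilde d(s)$ for all $s\in[0,t]$, then $\phi(t,x,d)=\phi(t,x,\tilde d)$; - continuity: for each $(x,d)$ the map $t\mapsto\phi(t,x,d)$ is continuous; - cocycle property: $\phi(h,\phi(t,x,d),d(t+\cdot))=\phi(t+h,x,d)$ for all $t,h\ge0$, $x\in X$, $d\in\mathcal{D}$. $0\in X$ is an equilibrium point (fixed point) if $\phi(t,0,d)=0$ for all $t\ge0$, $d\in\mathcal{D}$. Non-coercive Lyapunov function (with corresponding functions $\alpha\in\mathcal{K}$, $\psi_2\in\mathcal{K}_\infty$): a map $V:X\to\mathbb{R}_+$ (no continuity assumed) such that (a) for all $y\in X$, $s>0$, $d\in\mathcal{D}$: $\liminf_{h\to+0}V(\phi(s-h,y,d))\ge V(\phi(s,y,d))\ge\liminf_{h\to+0}V(\phi(s+h,y,d))$, and the right-hand inequality also holds for $s=0$; (b) $V(0)=0$ and $0<V(x)\le\psi_2(\|x\|_X)$ for all $x\in X\setminus\{0\}$; (c) $\dot V_d(x)\le-\alpha(\|x\|_X)$ for all $x\in X$, $d\in\mathcal{D}$, where $\dot V_d(x):=\liminf_{t\to+0}\frac1t\big(V(\phi(t,x,d))-V(x)\big)$. Other notions: - RFC (robustly forward complete): for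 all $C>0$, $\tau>0$, $\sup\{\|\phi(t,x,d)\|_X:\|x\|_X\le C,\ t\in[0,\tau],\ d\in\mathcal{D}\}<\infty$. - REP (robust equilibrium point): $0$ is an equilibrium point and for every $\varepsilon>0$, $h>0$ there is $\delta=\delta(\varepsilon,h)>0$ such that $t\in[0,h]$, $\|x\|_X\le\delta$, $d\in\mathcal{D}$ imply $\|\phi(t,x,d)\|_X\le\varepsilon$. - UGAS: there is $\beta\in\mathcal{KL}$ with $\|\phi(t,x,d)\|_X\le\beta(\|x\|_X,t)$ for all $x\in X$, $d\in\mathcal{D}$, $t\ge0$. - UAS: there are $\beta\in\mathcal{KL}$ and $r>0$ such that this inequality holds for all $\|x\|_X\le r$, $d\in\mathcal{D}$, $t\ge0$. - UGATT (uniformly globally attractive): for all $r,\varepsilon>0$ there is $\tau=\tau(r,\varepsilon)$ such that $\|x\|_X\le r$, $d\in\mathcal{D}$, $t\ge\tau$ imply $\|\phi(t,x,d)\|_X\le\varepsilon$. - iUGS with $\alpha\in\mathcal{K}$ and $\psi\in\mathcal{K}_\infty$: $\int_0^\infty\alpha(\|\phi(s,x,d)\|_X)\,ds\le\psi(\|x\|_X)$ for all $x\in X$, $d\in\mathcal{D}$. - iUGATT with $\alpha\in\mathcal{K}$: for all $r>0$, $\lim_{t\to\infty}\sup_{x\in\overline{B_r},\,d\in\mathcal{D}}\int_t^\infty\alpha(\|\phi(s,x,d)\|_X)\,ds=0$. - iUGAS: there are some $\alpha\in\mathcal{K}$ and $\beta\in\mathcal{KL}$ such that $\int_t^\infty\alpha(\|\phi(s,x,d)\|_X)\,ds\le\beta(\|x\|_X,t)$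 for all $x\in X$, $d\in\mathcal{D}$, $t\ge0$. *)

(* Defs.v *)
From HB Require Import structures.
From mathcomp Require Import all_boot all_order all_algebra.
From mathcomp Require Import all_classical all_reals all_analysis.

Set Implicit Arguments.
Unset Strict Implicit.
Unset Printing Implicit Defensive.

Import Order.TTheory GRing.Theory Num.Theory.
Import numFieldNormedType.Exports.

Local Open Scope classical_set_scope.
Local Open Scope ring_scope.

(* A function on R_+ = [0, +oo[ is represented by a function on R of which only
   the values at nonnegative arguments are ever constrained or used. *)

Section comparison_functions.
Context {R : realType}.

Definition class_K (g : R -> R) : Prop :=
  [/\ {within [set r : R | 0 <= r], continuous g},
      (forall r s : R, 0 <= r -> r < s -> g r < g s)
    & g 0 = 0].

Definition class_Kinfty (g : R -> R) : Prop :=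
  class_K g /\ (forall M : R, exists2 r : R, 0 <= r & M < g r).

Definition class_KL (b : R -> R -> R) : Prop :=
  [/\ {within [set p : R * R | 0 <= p.1 /\ 0 <= p.2],
        continuous (fun p : R * R => b p.1 p.2)},
      (forall t : R, 0 <= t -> class_K (b ^~ t)),
      (forall r : R, 0 < r -> forall s t : R, 0 <= s -> s < t -> b r t < b r s)
    & (forall r : R, 0 < r -> b r t @[t --> +oo] --> (0 : R))].

End comparison_functions.

Section disturbances.
Context {R : realType} {U : Type}.

Definition shift_dist (t : R) (d : R -> U) : R -> U := fun s => d (t + s).

Definition concat_dist (t : R) (d1 d2 : R -> U) : R -> U :=
  fun s => if s <= t then d1 s else d2 (s - t).

End disturbances.

(* [dval] is the set D of disturbance values, [dist] the set of admissible
   disturbances.  [flow t x d] is meaningful only for 0 <= t and d \in dist; by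
   [flow_causal] it ignores the values of d at negative times. *)
Record forward_complete_system (R : realType) (X U : normedModType R) := {
  dval : set U;
  dist : set (R -> U);
  flow : R -> X -> (R -> U) -> X;
  dval_nonempty : dval !=set0;
  dist_val : forall d, dist d -> forall s : R, 0 <= s -> dval (d s);
  dist_shift : forall d (t : R), dist d -> 0 <= t -> dist (shift_dist t d);
  dist_concat : forall d1 d2 (t : R), dist d1 -> dist d2 -> 0 < t ->
    dist (concat_dist t d1 d2);
  flow_id : forall x d, dist d -> flow 0 x d = x;
  flow_causal : forall (t : R) x d d', 0 <= t -> dist d -> dist d' ->
    (forall s : R, 0 <= s <= t -> d s = d' s) -> flow t x d = flow t x d';
  flow_continuous : forall x d, dist d ->
    {within [set t : R | 0 <= t], continuous (fun t : R => flow t x d)};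
  flow_cocycle : forall (t h : R) x d, 0 <= t -> 0 <= h -> dist d ->
    flow h (flow t x d) (shift_dist t d) = flow (t + h) x d
}.

Section stability.
Context {R : realType} {X U : normedModType R}.
Variable S : forward_complete_system X U.
Local Notation phi := (flow S).

Definition equilibrium : Prop :=
  forall (t : R) d, 0 <= t -> dist S d -> phi t 0 d = 0.

Definition Vdot (V : X -> R) (d : R -> U) (x : X) : \bar R :=
  limf_einf (fun t : R => (t^-1 * (V (phi t x d) - V x))%:E) (0 : R)^'+.

Record noncoercive_Lyapunov (alpha psi2 : R -> R) (V : X -> R) : Prop := {
  lyap_ge0 : forall x, 0 <= V x;
  lyap_left : forall (y : X) (s : R) d, 0 < s -> dist S d ->
    ((V (phi s y d))%:E
       <= limf_einf (fun h : R => (V (phi (s - h) y d))%R%:E) (0 : R)^'+)%E;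
  lyap_right : forall (y : X) (s : R) d, 0 <= s -> dist S d ->
    (limf_einf (fun h : R => (V (phi (s + h) y d))%R%:E) (0 : R)^'+
       <= (V (phi s y d))%:E)%E;
  lyap_0 : V 0 = 0;
  lyap_bounds : forall x : X, x != 0 -> 0 < V x <= psi2 `|x|;
  lyap_decay : forall (x : X) d, dist S d -> (Vdot V d x <= (- alpha `|x|)%R%:E)%E
}.

Definition RFC : Prop := forall C tau : R, 0 < C -> 0 < tau ->
  (ereal_sup [set e : \bar R | exists (t : R) (x : X) d,
     [/\ `|x| <= C, 0 <= t <= tau, dist S d & e = `|phi t x d|%:E]]%R
   < +oo)%E.

Definition REP : Prop := equilibrium /\
  forall eps h : R, 0 < eps -> 0 < h -> exists2 delta : R, 0 < delta &
    forall (t : R) (x : X) d, 0 <= t <= h -> `|x| <= delta -> dist S d ->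
      `|phi t x d| <= eps.

Definition UGAS : Prop := exists2 beta, class_KL beta &
  forall (x : X) d (t : R), dist S d -> 0 <= t -> `|phi t x d| <= beta `|x| t.

Definition UAS : Prop := exists2 beta, class_KL beta & exists2 r : R, 0 < r &
  forall (x : X) d (t : R), `|x| <= r -> dist S d -> 0 <= t ->
    `|phi t x d| <= beta `|x| t.

Definition UGATT : Prop := forall r eps : R, 0 < r -> 0 < eps ->
  exists2 tau : R, 0 <= tau &
    forall (x : X) d (t : R), `|x| <= r -> dist S d -> tau <= t -> `|phi t x d| <= eps.

Definition tail_integral (alpha : R -> R) (t : R) (x : X) (d : R -> U)
    : \bar R :=
  (\int[@lebesgue_measure R]_(s in `[t, +oo[) (alpha `|phi s x d|)%R%:E)%E.

Definition iUGS (alpha psi : R -> R) : Prop := forall (x : X) d, dist S d ->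
  (tail_integral alpha 0 x d <= (psi `|x|)%R%:E)%E.

(* The supremum is taken in [0, +oo]: adding 0 to the set only serves to make
   the supremum of the empty set (no admissible disturbance) equal to 0. *)
Definition iUGATT (alpha : R -> R) : Prop := forall r : R, 0 < r ->
  ereal_sup ([set 0%E] `|` [set e : \bar R | exists (x : X) d,
     [/\ closed_ball (0 : X) r x, dist S d & e = tail_integral alpha t x d]])
    @[t --> +oo] --> 0%E.

Definition iUGAS : Prop := exists alpha beta,
  [/\ class_K alpha, class_KL beta
    & forall (x : X) d (t : R), dist S d -> 0 <= t ->
        (tail_integral alpha t x d <= (beta `|x| t)%R%:E)%E].

End stability.

(* Main.v *)
(* Along a trajectory [phi], [V] decreases at least as fast as the integral of
   [alpha |phi|], so the tail of that integral from time [t] on is at most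
   [V (phi t) <= psi2 |phi t|].  The bound [psi2 r] on the whole integral forces
   the trajectory to visit any ball of radius [delta] before time
   [(psi2 r + 1) / alpha delta]; restarting there makes the tails uniformly
   small.  Under REP a small integral over [[t - 1, t]] provides a time shortly
   before [t] at which the state is small, hence the state is small at [t]:
   this yields both uniform stability and uniform attractivity.  The KL bounds
   are then obtained from the "epsilon-delta" forms by Lipschitz envelopes. *)

Require Import Defs.
From mathcomp Require Import all_boot all_order all_algebra.
From mathcomp Require Import all_classical all_reals all_analysis.
From mathcomp Require Import measurable_realfun.
From mathcomp Require Import lra.

Set Implicit Arguments.
Unset Strict Implicit.
Unset Printing Implicit Defensive.

Import Order.TTheory GRing.Theory Num.Theory.
Import numFieldNormedType.Exports.

Local Open Scope classical_set_scope.
Local Open Scope ring_scope.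

(** * Right Dini derivatives and integrals *)

Section real_functions.
Context {R : realType}.
Implicit Type f : R -> R.

Lemma within_continuous_ge0P f :
  {within [set r : R | 0 <= r], continuous f} <->
  (forall s eps : R, 0 <= s -> 0 < eps -> exists2 delta : R, 0 < delta &
     forall u : R, 0 <= u -> `|u - s| < delta -> `|f u - f s| < eps).
Proof.
split.
- move=> /subspace_continuousP cf s eps s0 eps0.
  have /cvgrPdist_lt /(_ eps eps0) := cf s s0.
  rewrite /within /= => /nbhs_ballP[d /= d0 dP].
  exists d => // u u0 us; rewrite distrC; apply: dP => //.
  by rewrite /ball /= distrC.
- move=> cf; apply/subspace_continuousP => s s0.
  apply/cvgrPdist_lt => eps eps0.
  have [d d0 dP] := cf s eps s0 eps0.
  apply/nbhs_ballP; exists d => //= u; rewrite /ball /= => us u0.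
  by rewrite distrC; apply: dP => //; rewrite distrC.
Qed.

Lemma limf_einf_ge0P f (l : R) :
  (l%:E <= limf_einf (fun h : R => (f h)%:E) (0 : R)^'+)%E ->
  forall eta : R, 0 < eta -> exists2 delta : R, 0 < delta &
    forall h : R, 0 < h < delta -> l - eta < f h.
Proof.
rewrite limf_einfE => lf eta eta0.
have : ((l - eta)%:E < ereal_sup [set ereal_inf ((fun h : R => (f h)%:E) @` B) |
  B in (0 : R)^'+])%E.
  by apply: lt_le_trans lf; rewrite lte_fin; lra.
move=> /ereal_sup_gt[_ [B [d /= d0 dB] <-] lB].
exists d => // h /andP[h0 hd].
rewrite -lte_fin; apply: (lt_le_trans lB); apply: ereal_inf_lbound.
exists h => //; apply: dB => //=.
by rewrite sub0r normrN gtr0_norm.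
Qed.

(** If [f] stayed at or above [l + eta] on []0, delta[], which belongs to the filter, the lower
    limit would be at least [l + eta]. *)
Lemma limf_einf_le0P f (l : R) :
  (limf_einf (fun h : R => (f h)%:E) (0 : R)^'+ <= l%:E)%E ->
  forall eta delta : R, 0 < eta -> 0 < delta ->
    exists2 h : R, 0 < h < delta & f h < l + eta.
Proof.
rewrite limf_einfE => lf eta delta eta0 delta0.
apply: contrapT => nh.
have : ((l + eta)%:E <= l%:E)%E; last by rewrite lee_fin; lra.
apply: le_trans lf; apply: le_ereal_sup_tmp.
exists (ereal_inf ((fun h : R => (f h)%:E) @` [set h | 0 < h < delta])).
  exists [set h | 0 < h < delta] => //.
  exists delta => //= h; rewrite /ball /= sub0r normrN => hd h0.
  by rewrite h0 /= -(gtr0_norm h0).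
apply: le_ereal_inf_tmp => _ [h hh <-]; rewrite lee_fin leNgt.
by apply/negP => fh; apply: nh; exists h.
Qed.

Lemma integral_co_cst (p q c : R) : p <= q ->
  (\int[@lebesgue_measure R]_(s in `[p, q[) (cst c%:E) s = (c * (q - p))%:E)%E.
Proof.
rewrite le_eqVlt => /predU1P[->|pq].
  by rewrite set_itvco0 integral_set0 subrr mulr0.
by rewrite integral_cst //= lebesgue_measure_itv /= lte_fin pq EFinM EFinB.
Qed.

(** * Integrals over half-open intervals and lower Dini derivatives *)

Section integral_bounds.
Variable a : R -> R.
Hypothesis ca : {within [set r : R | 0 <= r], continuous a}.
Hypothesis a_ge0 : forall s : R, 0 <= s -> 0 <= a s.
Local Notation mu := (@lebesgue_measure R).

Lemma measurable_continuous_ge0 (D : set R) :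
  D `<=` [set r : R | 0 <= r] ->
  measurable_fun D (fun s => (a s)%:E).
Proof.
move=> D0.
have m0 : measurable [set r : R | 0 <= r].
  by rewrite -set_itvcy; exact: measurable_itv.
apply: (measurable_funS m0 D0); apply/measurable_EFinP.
exact: subspace_continuous_measurable_fun.
Qed.

Lemma itv_ge0_sub (p : R) (y : itv_bound R) : 0 <= p ->
  [set` Interval (BLeft p) y] `<=` [set r : R | 0 <= r].
Proof.
move=> p0 u /=; rewrite itv_boundlr => /andP[+ _].
by rewrite bnd_simp; exact: le_trans.
Qed.

Lemma integral_co_le (p q c : R) : 0 <= p <= q ->
  (forall s, p <= s < q -> a s <= c) ->
  (\int[mu]_(s in `[p, q[) (a s)%:E <= (c * (q - p))%:E)%E.
Proof.
move=> /andP[p0 pq] ac.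
rewrite -integral_co_cst //.
apply: ge0_le_integral => //=.
- by move=> s; rewrite in_itv /= => /andP[ps _]; rewrite lee_fin a_ge0 //; lra.
- by apply: measurable_continuous_ge0; exact: itv_ge0_sub.
Qed.

Lemma integral_co_ge (p q c : R) : 0 <= p <= q -> 0 <= c ->
  (forall s, p <= s < q -> c <= a s) ->
  ((c * (q - p))%:E <= \int[mu]_(s in `[p, q[) (a s)%:E)%E.
Proof.
move=> /andP[p0 pq] c0 ac.
rewrite -integral_co_cst //.
apply: ge0_le_integral => //=.
- by apply: measurable_continuous_ge0; exact: itv_ge0_sub.
Qed.

Lemma integral_coD (p q r : R) : 0 <= p <= q -> q <= r ->
  (\int[mu]_(s in `[p, r[) (a s)%:E =
   \int[mu]_(s in `[p, q[) (a s)%:E + \int[mu]_(s in `[q, r[) (a s)%:E)%E.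
Proof.
move=> /andP[p0 pq] qr.
have U : `[p, q[ `|` `[q, r[ = `[p, r[%classic :> set R.
  by rewrite -itv_bndbnd_setU // bnd_simp.
rewrite -U; apply: ge0_integral_setU => //.
- by rewrite U; apply: measurable_continuous_ge0; exact: itv_ge0_sub.
- by rewrite U => s /(itv_ge0_sub p0) /= s0; rewrite lee_fin a_ge0.
- apply/disj_setPS => s [] /=; rewrite !in_itv /= => /andP[_ sq] /andP[qs _].
  by move: (lt_le_trans sq qs); rewrite ltxx.
Qed.

(** Monotone convergence along the increasing intervals [[p, p + n[]. *)
Lemma integral_cy_le (p : R) (M : \bar R) : 0 <= p ->
  (forall q, p <= q -> (\int[mu]_(s in `[p, q[) (a s)%:E <= M)%E) ->
  (\int[mu]_(s in `[p, +oo[) (a s)%:E <= M)%E.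
Proof.
move=> p0 IM.
pose F (n : nat) : set (measurableTypeR R) := `[p, p + n%:R[%classic.
have UF : \bigcup_n F n = `[p, +oo[%classic.
  apply/seteqP; split => s /=.
    by move=> [n _]; rewrite /F /= !in_itv /= andbT => /andP[].
  rewrite in_itv /= andbT => ps.
  exists (Num.truncn (s - p)).+1 => //; rewrite /F /= in_itv /= ps /=.
  have := truncnS_gt (s - p); lra.
have ndF : nondecreasing_seq F.
  move=> m n mn; apply/subsetPset => s; rewrite /F /= !in_itv /= => /andP[-> sm].
  by rewrite (lt_le_trans sm) // lerD2l ler_nat.
have := @ge0_nondecreasing_set_cvg_integral _ _ R F (fun s => (a s)%:E)
  lebesgue_measure ndF.
rewrite UF => cv; apply: (cvge_to_le (cv _ _ _)).
- by move=> i; exact: measurable_itv.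
- by move=> i; apply: measurable_continuous_ge0; exact: itv_ge0_sub.
- by move=> i s /(itv_ge0_sub p0) /= s0; rewrite lee_fin a_ge0.
- by apply: nearW => n; apply: IM; rewrite lerDl.
Qed.

(* The supremum of the times up to which the estimate holds with error rate [e]
   is itself such a time, by lower semicontinuity from the left, and the bound
   [- a] on the lower right Dini derivative pushes it to the final time. *)
Lemma integral_le_dini (v : R -> R) :
  (forall s eta : R, 0 < s -> 0 < eta -> exists2 delta : R, 0 < delta &
     forall h : R, 0 < h < delta -> v s - eta < v (s - h)) ->
  (forall s eta delta : R, 0 <= s -> 0 < eta -> 0 < delta ->
     exists2 h : R, 0 < h < delta & v (s + h) - v s <= h * (- a s + eta)) ->
  forall p q : R, 0 <= p <= q ->
    (\int[mu]_(s in `[p, q[) (a s)%:E <= (v p - v q)%:E)%E.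
Proof.
move=> vl vd p q /andP[p0 pq].
suff H (e : R) : 0 < e ->
    (\int[mu]_(s in `[p, q[) (a s)%:E <= (v p - v q + e * (q - p))%:E)%E.
  apply/lee_addgt0Pr => e e0.
  (* This rate makes the total error over [[p, q[] at most [e]; the [+ 1] covers [p = q]. *)
  have e'0 : 0 < e / (q - p + 1) by apply: divr_gt0 => //; lra.
  apply: (le_trans (H _ e'0)); rewrite -EFinD lee_fin lerD2l.
  rewrite -mulrA ger_pMr // mulrC ler_pdivrMr; lra.
move=> e0.
pose I (s : R) := (\int[mu]_(s in `[p, s[) (a s)%:E)%E.
pose A := [set s : R | p <= s <= q /\ (I s <= (v p - v s + e * (s - p))%:E)%E].
have Ap : A p.
  split; first by rewrite lexx.
  by rewrite /I set_itvco0 // integral_set0 !subrr mulr0 addr0.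
have supA : has_sup A by split; [exists p|exists q => s [/andP[]]].
set z := sup A.
have pz : p <= z by apply: sup_upper_bound.
have zq : z <= q by apply: ge_sup; [exists p|move=> s [/andP[]]].
have acont (s eta : R) : 0 <= s -> 0 < eta -> exists2 delta : R, 0 < delta &
    forall u : R, 0 <= u -> `|u - s| < delta -> a u <= a s + eta.
  move=> s0 eta0; have [d d0 dP] := (within_continuous_ge0P a).1 ca s eta s0 eta0.
  exists d => // u u0 us; have := dP u u0 us; rewrite ltr_norml; lra.
have Istep (s t c : R) : p <= s <= t -> (forall u : R, s <= u < t -> a u <= c) ->
    forall w, (I s <= w%:E)%E -> (I t <= (w + c * (t - s))%:E)%E.
  move=> /andP[ps st] ac w Iw; rewrite /I (@integral_coD p s t) //; last lra.
  by rewrite EFinD leeD // integral_co_le //; lra.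
(* The supremum is attained: from some [s] in [A] just below [z], lower semicontinuity of [v] from
   the left costs at most [eta / 2], and the integral over [[s, z[] costs at most
   [c * (z - s) < eta / 2]. *)
have Az : A z.
  split; first lra.
  apply/lee_addgt0Pr => eta eta0; rewrite -EFinD.
  have [pz'|zp] := ltP p z; last first.
    have -> : z = p by lra.
    by case: Ap => _ /le_trans; apply; rewrite lee_fin; lra.
  have eta2 : 0 < eta / 2 by lra.
  have z0 : 0 < z by lra.
  have [d1 d10 d1P] := vl z (eta / 2) z0 eta2.
  have [d2 d20 d2P] := acont z 1 (ltW z0) ltr01.
  set c := a z + 1.
  have c0 : 0 < c by have := a_ge0 (ltW z0); rewrite /c; lra.
  have d3 : 0 < Num.min (Num.min d1 d2) (eta / 2 / c).
    by rewrite !lt_min d10 d20 divr_gt0.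
  have [s As] := sup_adherent d3 supA; rewrite -/z => zs.
  have sz : s <= z by apply: sup_upper_bound.
  case: As => /andP[ps sq] Is.
  have [->|sz'] := eqVneq z s; first by apply: (le_trans Is); rewrite lee_fin; lra.
  have {sz} {}sz' : s < z by rewrite lt_neqAle eq_sym sz'.
  have : z - s < Num.min (Num.min d1 d2) (eta / 2 / c) by lra.
  rewrite !lt_min => /andP[/andP[zs1 zs2]]; rewrite ltr_pdivlMr // => zs3.
  have h1 : 0 < z - s < d1 by lra.
  have := d1P _ h1; rewrite subKr => vz.
  have psz : p <= s <= z by lra.
  have ac (u : R) : s <= u < z -> a u <= c.
    move=> /andP[su uz]; apply: d2P; first lra.
    by rewrite distrC gtr0_norm; lra.
  apply: (le_trans (Istep s z c psz ac _ Is)); rewrite lee_fin.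
  have : e * (s - p) <= e * (z - p) by rewrite ler_pM2l //; lra.
  by move: zs3; rewrite mulrC; lra.
have [zq'|qz] := ltP z q; last first.
  have zqE : z = q by lra.
  by rewrite -zqE; case: Az.
have z0 : 0 <= z by lra.
(* One half of the rate [e] pays for the error in the Dini derivative at [z], the other half for the
   variation of [a] to the right of [z]. *)
have e2 : 0 < e / 2 by lra.
have [d1 d10 d1P] := acont z (e / 2) z0 e2.
have d2 : 0 < Num.min d1 (q - z) by rewrite lt_min d10; lra.
have [h /andP[h0]] := vd z (e / 2) _ z0 e2 d2.
rewrite lt_min => /andP[hd hq] vh.
have Azh : A (z + h).
  split; first lra.
  have zzh : p <= z <= z + h by lra.
  have ac (u : R) : z <= u < z + h -> a u <= a z + e / 2.
    move=> /andP[zu uz]; apply: d1P; first lra.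
    by rewrite ger0_norm; lra.
  apply: (le_trans (Istep z (z + h) _ zzh ac _ Az.2)); rewrite lee_fin.
  lra.
have : z + h <= z by apply: sup_upper_bound.
by rewrite gerDl leNgt h0.
Qed.

End integral_bounds.
End real_functions.

(** * Bounds by comparison functions *)

Section envelope.
Context {R : realType}.
Variable B : set (R * R).

(* The largest nondecreasing 1-Lipschitz function [m] with [m s <= y] for all
   [(y, s)] in [B]. *)
Definition envelope (t : R) : R :=
  inf [set p.1 + Num.max 0 (t - p.2) | p in B].

Hypothesis B_neq0 : B !=set0.
Hypothesis B_ge0 : forall p, B p -> 0 <= p.1.

Lemma envelope_le t p : B p -> envelope t <= p.1 + Num.max 0 (t - p.2).
Proof.
move=> Bp; apply: ge_inf; last by exists p.
exists 0 => _ [u Bu <-]; rewrite addr_ge0 ?B_ge0 //.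
by rewrite le_max lexx.
Qed.

Lemma envelope_ge t c :
  (forall p, B p -> c <= p.1 + Num.max 0 (t - p.2)) -> c <= envelope t.
Proof.
move=> cB; apply: lb_le_inf.
  by have [p Bp] := B_neq0; exists (p.1 + Num.max 0 (t - p.2)); exists p.
by move=> _ [p Bp <-]; exact: cB.
Qed.

(** Each function [t |-> y + max 0 (t - s)] is nondecreasing and 1-Lipschitz, and both properties
    pass to the infimum. *)
Lemma envelope_nondecreasing s t : s <= t -> envelope s <= envelope t.
Proof.
move=> st; apply: envelope_ge => p Bp; apply: (le_trans (envelope_le s Bp)).
by rewrite lerD2l le_max2 // lerD2r.
Qed.

Lemma envelope_lipschitz s t : s <= t -> envelope t <= envelope s + (t - s).
Proof.
move=> st; rewrite -lerBlDr; apply: envelope_ge => p Bp.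
rewrite lerBlDr; apply: (le_trans (envelope_le t Bp)).
rewrite -addrA lerD2l ge_max; apply/andP; split.
  by rewrite addr_ge0 ?subr_ge0 // le_max lexx.
have : s - p.2 <= Num.max 0 (s - p.2) by rewrite le_max lexx orbT.
lra.
Qed.

Lemma continuous_envelope : continuous envelope.
Proof.
move=> s; apply/cvgrPdist_lt => eps eps0; apply/nbhs_ballP; exists eps => //= t.
rewrite /ball /=; apply: le_lt_trans.
have [st|/ltW ts] := leP s t.
  have := envelope_nondecreasing st; have := envelope_lipschitz st.
  by move=> ? ?; rewrite [X in _ <= X]ler0_norm ?ler_norml; lra.
have := envelope_nondecreasing ts; have := envelope_lipschitz ts.
by move=> ? ?; rewrite [X in _ <= X]ger0_norm ?ler_norml; lra.
Qed.

End envelope.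

(** * Majorants of class K and KL *)

Section comparison_bounds.
Context {R : realType}.

Lemma class_K_continuous_at (g : R -> R) (r : R) : class_K g -> 0 <= r ->
  g x @[x --> within [set r : R | 0 <= r] (nbhs r)] --> g r.
Proof. by case=> /subspace_continuousP cg _ _; exact: cg. Qed.

Lemma class_K_ge0 (g : R -> R) (r : R) : class_K g -> 0 <= r -> 0 <= g r.
Proof.
move=> [_ g_incr g0]; rewrite le_eqVlt => /predU1P[<-|r0]; first by rewrite g0.
by rewrite -g0 ltW // g_incr.
Qed.

Lemma class_K_gt0 (g : R -> R) (r : R) : class_K g -> 0 < r -> 0 < g r.
Proof. by move=> [_ g_incr g0] r0; rewrite -g0 g_incr. Qed.

Lemma class_K_le (g : R -> R) (r s : R) : class_K g -> 0 <= r -> r <= s ->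
  g r <= g s.
Proof.
move=> [_ g_incr _] r0; rewrite le_eqVlt => /predU1P[->//|rs].
by rewrite ltW // g_incr.
Qed.

Lemma class_K_small (g : R -> R) (eps : R) : class_K g -> 0 < eps ->
  exists2 delta : R, 0 < delta & g delta <= eps.
Proof.
move=> Kg eps0; have [/within_continuous_ge0P cg _ g0] := Kg.
have [d d0 dP] := cg 0 eps (lexx 0) eps0.
exists (d / 2); first by lra.
have d2 : 0 <= d / 2 by lra.
have := dP _ d2; rewrite g0 !subr0 (ger0_norm d2).
rewrite (ger0_norm (class_K_ge0 Kg d2)) => dd.
by apply/ltW/dd; lra.
Qed.

(* In the variable [1 / r] the small-value condition becomes growth at infinity
   of [1 / y], so that [1 / y] has an envelope tending to infinity. *)
Lemma class_K_bound (P : R -> R -> Prop) :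
  (forall r y, P r y -> 0 <= r) ->
  (forall eps : R, 0 < eps -> exists2 delta : R, 0 < delta &
     forall r y, P r y -> r <= delta -> y <= eps) ->
  (forall C : R, 0 < C -> exists M, forall r y, P r y -> r <= C -> y <= M) ->
  exists2 sigma, class_K sigma & forall r y, P r y -> y <= sigma r.
Proof.
move=> P0 Psmall Pbnd.
(* The point [(1, 1)] keeps [B] nonempty, as the infimum of the empty set would default to 0. *)
pose B : set (R * R) := [set p | p = (1, 1) \/
  exists r y, [/\ P r y, 0 < r, 0 < y & p = (y^-1, r^-1)]].
have BN : B !=set0 by exists (1, 1); left.
have B0 p : B p -> 0 <= p.1.
  by move=> [->|[r [y [_ _ y0 ->]]]] /=; rewrite ?ler01 // invr_ge0 ltW.
(* Points with [r <= 2 / q] have [1 / y >= 1 / M] by boundedness; for the others the Lipschitz term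
   alone exceeds [q / 2]. *)
have env_gt0 (q : R) : 0 < q -> 0 < envelope B q.
  move=> q0.
  have C0 : 0 < 2 / q by rewrite divr_gt0.
  have [M0 M0P] := Pbnd _ C0.
  pose M := Num.max M0 1.
  have M1 : 1 <= M by rewrite le_max lexx orbT.
  have M_gt0 : 0 < M by lra.
  apply: (@lt_le_trans _ _ (Num.min M^-1 (q / 2))).
    by rewrite lt_min invr_gt0 M_gt0 divr_gt0.
  apply: envelope_ge => // p [->|[r [y [Pry r0 y0 ->]]]] /=.
    rewrite ge_min; apply/orP; left.
    rewrite (le_trans (_ : M^-1 <= 1)) ?invf_le1 //.
    have : 0 <= Num.max 0 (q - 1) by rewrite le_max lexx.
    lra.
  have [rC|Cr] := leP r (2 / q); rewrite ge_min; apply/orP.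
    left.
    have : M^-1 <= y^-1 by rewrite lef_pV2 ?posrE // le_max (M0P _ _ Pry).
    have : 0 <= Num.max 0 (q - r^-1) by rewrite le_max lexx.
    lra.
  right.
  have : r^-1 < q / 2 by rewrite -[ltRHS]invf_div ltf_pV2 ?posrE.
  have : q - r^-1 <= Num.max 0 (q - r^-1) by rewrite le_max lexx orbT.
  have : 0 < y^-1 by rewrite invr_gt0.
  lra.
(* The envelope is only nondecreasing; the summand [r] makes [sigma] strictly increasing. *)
pose sigma r := if 0 < r then r + (envelope B r^-1)^-1 else 0.
have sigmaE r : 0 < r -> sigma r = r + (envelope B r^-1)^-1.
  by rewrite /sigma => ->.
have sigma0 : sigma 0 = 0 by rewrite /sigma ltxx.
have sigma_gt0 r : 0 < r -> 0 < sigma r.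
  by move=> r0; rewrite sigmaE // addr_gt0 // invr_gt0 env_gt0 ?invr_gt0.
exists sigma; last first.
  move=> r y Pry; have r0 := P0 _ _ Pry.
  have [y0|y0] := leP y 0.
    apply: (le_trans y0); move: r0; rewrite le_eqVlt => /predU1P[<-|/sigma_gt0/ltW//].
    by rewrite sigma0.
  have {}r0 : 0 < r.
    rewrite lt_neqAle r0 andbT; apply/eqP => r00.
    have y2 : 0 < y / 2 by lra.
    have [d d0 dP] := Psmall _ y2.
    have := dP _ _ Pry; rewrite -r00 => /(_ (ltW d0)); lra.
  have Bp : B (y^-1, r^-1) by right; exists r, y.
  have := envelope_le B0 r^-1 Bp; rewrite /= subrr maxxx addr0 => eny.
  have : y <= (envelope B r^-1)^-1.
    by rewrite -[leLHS]invrK lef_pV2 ?posrE ?env_gt0 ?invr_gt0.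
  by rewrite sigmaE //; lra.
split=> //; last first.
  move=> r s; rewrite le_eqVlt => /predU1P[<-|r0 rs]; first by rewrite sigma0 => /sigma_gt0.
  have s0 : 0 < s by lra.
  rewrite !sigmaE // ltr_leD // lef_pV2 ?posrE ?env_gt0 ?invr_gt0 //.
  by apply: envelope_nondecreasing => //; rewrite lef_pV2 ?posrE // ltW.
apply/within_continuous_ge0P => s eps; rewrite le_eqVlt => /predU1P[<-|s0] eps0.
  have eps2 : 0 < eps / 2 by lra.
  have [d0 d00 d0P] := Psmall _ eps2.
  (* Points with [r <= d] have [y <= eps / 2]; those with [r >= d] get a Lipschitz term of at least
     [2 / eps] once [1 / u > 2 / eps + 1 / d]. Having [d < 1] puts the extra point [(1, 1)] among
     the latter. *)
  pose d := Num.min d0 (1 / 2).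
  have d_gt0 : 0 < d by rewrite lt_min d00; lra.
  have dd0 : d <= d0 by rewrite ge_min lexx.
  have d1 : d < 1 by rewrite gt_min; apply/orP; right; lra.
  have Q0 : 0 < 2 / eps + d^-1 by rewrite addr_gt0 ?invr_gt0 // divr_gt0.
  exists (Num.min (eps / 2) (2 / eps + d^-1)^-1); first by rewrite lt_min eps2 invr_gt0.
  move=> u; rewrite le_eqVlt => /predU1P[<-|u0]; first by rewrite sigma0 subrr normr0.
  rewrite sigma0 !subr0 gtr0_norm // lt_min => /andP[ue uq].
  rewrite gtr0_norm ?sigma_gt0 // sigmaE //.
  suff : (envelope B u^-1)^-1 <= eps / 2 by lra.
  rewrite -[leRHS]invf_div lef_pV2 ?posrE ?env_gt0 ?invr_gt0 ?divr_gt0 //.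
  have {}uq : 2 / eps + d^-1 < u^-1.
    by rewrite -[ltLHS]invrK ltf_pV2 ?posrE ?invr_gt0.
  have far (x : R) : d <= x -> 2 / eps <= u^-1 - x^-1.
    move=> dx; have : x^-1 <= d^-1 by rewrite lef_pV2 ?posrE //; lra.
    lra.
  apply: envelope_ge => // p [->|[r [y [Pry r0 y0 ->]]]] /=.
    have /far : d <= 1 by lra.
    rewrite invr1; have : u^-1 - 1 <= Num.max 0 (u^-1 - 1).
      by rewrite le_max lexx orbT.
    lra.
  have [rd|/ltW dr] := leP r d.
    have : 2 / eps <= y^-1.
      rewrite -[leLHS]invf_div lef_pV2 ?posrE ?divr_gt0 //.
      by apply: (d0P _ _ Pry); lra.
    have : 0 <= Num.max 0 (u^-1 - r^-1) by rewrite le_max lexx.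
    lra.
  apply: (le_trans (far _ dr)).
  have : u^-1 - r^-1 <= Num.max 0 (u^-1 - r^-1) by rewrite le_max lexx orbT.
  have : 0 < y^-1 by rewrite invr_gt0.
  lra.
have cs : (fun r => r + (envelope B r^-1)^-1) x @[x --> s] -->
    s + (envelope B s^-1)^-1.
  apply: cvgD; first exact: cvg_id.
  apply: cvgV; first by rewrite gt_eqF ?env_gt0 ?invr_gt0.
  apply: (@cvg_comp _ _ _ (fun x : R => x^-1) (envelope B) _ (nbhs s^-1)).
    by apply: cvgV; [rewrite gt_eqF|exact: cvg_id].
  exact: continuous_envelope.
have /cvgrPdist_lt/(_ _ eps0)/nbhs_ballP[d /= d0 dP] := cs.
(* Distance less than [s] keeps [u] positive, away from the zero branch of [sigma]. *)
exists (Num.min d s); first by rewrite lt_min d0.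
move=> u _; rewrite lt_min => /andP[ud us].
have u0 : 0 < u by move: us; rewrite ltr_norml => /andP[]; lra.
by rewrite !sigmaE // distrC; apply: dP; rewrite /ball /= distrC.
Qed.

(** The envelope of the bad points is at most [m] at each bad [(m, s)], and it tends to infinity
    because bad points of bounded height stop occurring after some time. The factor
    [1 - 1 / (2 + t)], at least [1 / 2] and below 1, makes both the growth and the avoidance
    strict. *)
Lemma slow_growth (Bad : R -> R -> Prop) :
  (forall m s, Bad m s -> 1 <= m) ->
  (forall L : R, exists T, forall m s, Bad m s -> m <= L -> s <= T) ->
  exists M : R -> R,
  [/\ (forall t : R, 0 <= t -> {for t, continuous M}),
      (forall t : R, 0 <= t -> 0 < M t),
      (forall s t : R, 0 <= s -> s < t -> M s < M t),
      (forall K : R, exists T : R, forall t, T <= t -> K <= M t)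
    & (forall t : R, 0 <= t -> ~ Bad (M t) t)].
Proof.
move=> Bad1 Badfar.
pose B : set (R * R) := [set p | p = (1, 0) \/ Bad p.1 p.2].
have BN : B !=set0 by exists (1, 0); left.
have B1 p : B p -> 1 <= p.1 by move=> [->//|/Bad1].
have B0 p : B p -> 0 <= p.1 by move=> /B1; lra.
have env1 (t : R) : 1 <= envelope B t.
  apply: envelope_ge => // p /B1.
  have : 0 <= Num.max 0 (t - p.2) by rewrite le_max lexx.
  lra.
have half (t : R) : 0 <= t -> (2 + t)^-1 <= 2^-1.
  by move=> t0; rewrite lef_pV2 ?posrE; lra.
have inv_gt0 (t : R) : 0 <= t -> 0 < (2 + t)^-1 by move=> t0; rewrite invr_gt0; lra.
exists (fun t => envelope B t * (1 - (2 + t)^-1)); split.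
- move=> t t0; apply: cvgM; first exact: continuous_envelope.
  apply: cvgB; first exact: cvg_cst.
  apply: cvgV; first by rewrite gt_eqF //; lra.
  by apply: cvgD; [exact: cvg_cst|exact: cvg_id].
- move=> t t0; rewrite mulr_gt0 //; first by have := env1 t; lra.
  by have := half t t0; lra.
- move=> s t s0 st; have t0 : 0 <= t by lra.
  apply: (@le_lt_trans _ _ (envelope B t * (1 - (2 + s)^-1))).
    rewrite ler_wpM2r //; first by have := half s s0; lra.
    by apply: envelope_nondecreasing => //; exact: ltW.
  rewrite ltr_pM2l; last by have := env1 t; lra.
  by rewrite ltrD2l ltrN2 ltf_pV2 ?posrE; lra.
(* Since the factor is at least [1 / 2], it suffices that the envelope reaches [L]. *)
- move=> K; pose L := 2 * Num.max K 1.
  have KL : K <= L / 2 by rewrite /L mulrC mulKf ?pnatr_eq0 // le_max lexx.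
  have L2 : 2 <= L.
    by have : 1 <= Num.max K 1; [rewrite le_max lexx orbT|rewrite /L; lra].
  have [T0 T0P] := Badfar L.
  have TT0 : T0 <= Num.max 0 T0 by rewrite le_max lexx orbT.
  have T00 : 0 <= Num.max 0 T0 by rewrite le_max lexx.
  exists (Num.max 0 T0 + L) => t Tt; have t0 : 0 <= t by lra.
  have envL : L <= envelope B t.
    (* Points of height at most [L] lie at times up to [max 0 T0], so a further time [L] lifts their
       Lipschitz term to [L]; the other points are already higher than [L]. *)
    apply: envelope_ge => // p Bp; have := B1 _ Bp => p1.
    have m1 : t - p.2 <= Num.max 0 (t - p.2) by rewrite le_max lexx orbT.
    have m0 : 0 <= Num.max 0 (t - p.2) by rewrite le_max lexx.
    case: Bp => [pE|Bp]; first by move: p1 m1; rewrite pE /=; lra.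
    by have [/(T0P _ _ Bp)|] := leP p.1 L; lra.
  apply: (le_trans KL); rewrite ler_pM //; first by lra.
  by have := half t t0; lra.
- move=> t t0 Badt.
  have Bt : B (envelope B t * (1 - (2 + t)^-1), t) by right.
  have := envelope_le B0 t Bt; rewrite /= subrr maxxx addr0.
  apply/negP; rewrite -ltNge gtr_pMr; last by have := env1 t; lra.
  by have := inv_gt0 t t0; lra.
Qed.

Lemma class_K_comp_fst (g : R -> R) (p : R * R) : class_K g -> 0 <= p.1 ->
  g q.1 @[q --> within [set p : R * R | 0 <= p.1 /\ 0 <= p.2] (nbhs p)] --> g p.1.
Proof.
move=> Kg p1.
apply: (@cvg_comp _ _ _ fst g _ (within [set r : R | 0 <= r] (nbhs p.1)));
  last exact: class_K_continuous_at.
have fst_p : fst q @[q --> p] --> p.1 by exact: cvg_fst.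
move=> C /fst_p; rewrite /within /= /nbhs /=; apply: filterS => q /= qC [q1 _].
exact: qC.
Qed.

(* Product form: if [w <= sigma r] and [w <= 1 / M t] whenever [r + 1 <= M t],
   then [w <= (1 + sigma r * (1 + r)) / M t]; the geometric mean of this bound
   with [sigma r] vanishes at [r = 0]. *)
Lemma class_KL_bound (W : R -> R -> R -> Prop) (sigma : R -> R) :
  class_K sigma ->
  (forall r t y, W r t y -> [/\ 0 <= r, 0 <= t & 0 <= y <= sigma r]) ->
  (forall r eps : R, 0 < r -> 0 < eps -> exists T, forall r' t y,
     W r' t y -> r' <= r -> T <= t -> y <= eps) ->
  exists2 beta, class_KL beta & forall r t y, W r t y -> y <= beta r t.
Proof.
move=> Ksigma W0 Watt.
(* [Bad m s] says that at time [s] it is too early for [M s = m]: some radius up to [m - 1] still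
   has a value above [1 / m]. *)
pose Bad m s := exists r y, [/\ W r s y, r + 1 <= m & m^-1 < y].
have Bad1 m s : Bad m s -> 1 <= m by move=> [r [y [/W0[r0 _ _] rm _]]]; lra.
have Badfar (L : R) : exists T, forall m s, Bad m s -> m <= L -> s <= T.
  (* Attractivity is applied with radius [L'] and tolerance [1 / L'], so [L'] has to be positive. *)
  pose L' := Num.max 1 L.
  have L'1 : 1 <= L' by rewrite le_max lexx.
  have LL' : L <= L' by rewrite le_max lexx orbT.
  have L'0 : 0 < L' by lra.
  have L'V : 0 < L'^-1 by rewrite invr_gt0.
  have [T TP] := Watt L' L'^-1 L'0 L'V.
  exists T => m s Bads mL; have m1 := Bad1 _ _ Bads.
  case: Bads => r [y [Wr rm ym]]; rewrite leNgt; apply/negP => Ts.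
  have rL : r <= L' by lra.
  have := TP _ _ _ Wr rL (ltW Ts).
  have : L'^-1 <= m^-1 by rewrite lef_pV2 ?posrE; lra.
  lra.
have [M [cM M0 Mincr Mgrow MBad]] := slow_growth Bad1 Badfar.
pose f (r : R) := sigma r * (1 + sigma r * (1 + r)).
have f_ge0 (r : R) : 0 <= r -> 0 <= f r.
  move=> r0; have := class_K_ge0 Ksigma r0 => s0.
  by rewrite mulr_ge0 // addr_ge0 // mulr_ge0 //; lra.
have f_incr (r s : R) : 0 <= r -> r < s -> f r < f s.
  move=> r0 rs; have s0 : 0 <= s by lra.
  have sr0 := class_K_ge0 Ksigma r0.
  have srs : sigma r < sigma s by case: Ksigma => _ + _; apply.
  rewrite /f ltr_pM //; first by rewrite addr_ge0 // mulr_ge0 //; lra.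
  by rewrite ltrD2l ltr_pM //; lra.
exists (fun r t => Num.sqrt (f r / M t)); last first.
  move=> r t y Wr; have [r0 t0 /andP[y0 ys]] := W0 _ _ _ Wr.
  have Mt := M0 t t0; have s0 := class_K_ge0 Ksigma r0.
  have yM : y <= (1 + sigma r * (1 + r)) / M t.
    rewrite ler_pdivlMr //.
    have [rM|Mr] := leP (r + 1) (M t).
      have : y <= (M t)^-1.
        by rewrite leNgt; apply/negP => My; apply: (MBad t t0); exists r, y.
      rewrite -(ler_pM2r Mt) mulVf ?gt_eqF // => yM1.
      have : 0 <= sigma r * (1 + r) by rewrite mulr_ge0 //; lra.
      lra.
    have : y * M t <= sigma r * (1 + r) by rewrite ler_pM //; lra.
    lra.
  rewrite -[leLHS]ger0_norm // -sqrtr_sqr ler_wsqrtr // expr2 /f -mulrA.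
  by rewrite ler_pM.
have cvg_sqrt (T : Type) (F : set_system T) (u : T -> R) (l : R) :
    Filter F -> u x @[x --> F] --> l -> Num.sqrt (u x) @[x --> F] --> Num.sqrt l.
  by move=> FF ul; apply: (cvg_comp _ _ ul); exact: sqrt_continuous.
split.
- apply/subspace_continuousP => -[r t] /= [r0 t0].
  apply: cvg_sqrt.
  apply: cvgM.
    rewrite /f; apply: cvgM; first exact: class_K_comp_fst.
    apply: cvgD; first exact: cvg_cst.
    apply: cvgM; first exact: class_K_comp_fst.
    apply: cvgD; first exact: cvg_cst.
    by apply: cvg_within_filter; exact: cvg_fst.
  apply: cvgV; first by rewrite gt_eqF ?M0.
  apply: cvg_within_filter; apply: continuous_cvg; first exact: cM.
  exact: cvg_snd.
- move=> t t0; split.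
  + apply/subspace_continuousP => r r0.
    apply: cvg_sqrt.
    apply: cvgM; last exact: cvg_cst.
    apply: cvgM; first exact: class_K_continuous_at.
    apply: cvgD; first exact: cvg_cst.
    apply: cvgM; first exact: class_K_continuous_at.
    apply: cvgD; first exact: cvg_cst.
    by apply: cvg_within_filter; exact: cvg_id.
  + move=> r s r0 rs; rewrite ltr_sqrt.
      by rewrite ltr_pM2r ?invr_gt0 ?M0 ?f_incr.
    by rewrite divr_gt0 ?M0 // (le_lt_trans (f_ge0 r r0)) // f_incr.
  + by rewrite /f; case: Ksigma => _ _ ->; rewrite !mul0r sqrtr0.
- move=> r r0 s t s0 st; have t0 : 0 <= t by lra.
  have fr : 0 < f r by rewrite (le_lt_trans (f_ge0 0 (lexx 0))) // f_incr.
  rewrite ltr_sqrt ?divr_gt0 ?M0 // ltr_pM2l // ltf_pV2 ?posrE ?M0 //.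
  exact: Mincr.
- move=> r r0; apply/cvgrPdist_le => eps eps0.
  have fr := f_ge0 r (ltW r0).
  (* This level of [M t] is what [sqrt (f r / M t) <= eps] amounts to. *)
  have [T TP] := Mgrow (f r / eps ^+ 2).
  exists (Num.max 0 T); split; first exact: num_real.
  move=> t; rewrite gt_max => /andP[/ltW t0 /ltW Tt].
  rewrite sub0r normrN ger0_norm ?sqrtr_ge0 //.
  rewrite -[leRHS](gtr0_norm eps0) -sqrtr_sqr ler_wsqrtr //.
  rewrite ler_pdivrMr ?M0 // mulrC -ler_pdivrMr ?exprn_gt0 //.
  exact: TP.
Qed.

End comparison_bounds.

(** * Non-coercive Lyapunov functions *)

Section noncoercive.
Context {R : realType} {X U : normedModType R}.
Variable S : forward_complete_system X U.
Variables (V : X -> R) (alpha psi2 : R -> R).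
Hypothesis halpha : class_K alpha.
Hypothesis hpsi2 : class_K psi2.
Hypothesis hV : noncoercive_Lyapunov S alpha psi2 V.
Local Notation phi := (flow S).

Lemma lyapunov_le x : V x <= psi2 `|x|.
Proof.
have [->|x0] := eqVneq x 0; last by have /andP[] := lyap_bounds hV x0.
by rewrite (lyap_0 hV) class_K_ge0.
Qed.

Lemma continuous_alpha_flow x d : dist S d ->
  {within [set s : R | 0 <= s], continuous (fun s : R => alpha `|phi s x d|)}.
Proof.
move=> dd; apply/subspace_continuousP => s s0.
have /subspace_continuousP cphi := flow_continuous (x := x) dd.
apply: (@cvg_comp _ _ _ (fun s : R => `|phi s x d|) alpha _
  (within [set r : R | 0 <= r] (nbhs `|phi s x d|)));
  last exact: class_K_continuous_at.
have cn : `|phi u x d| @[u --> within [set u : R | 0 <= u] (nbhs s)] -->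
    `|phi s x d| by apply: (cvg_comp _ _ (cphi s s0)); exact: norm_continuous.
move=> C /cn; apply: (@filterS _ _ (within_filter _ _)) => u.
by apply; exact: normr_ge0.
Qed.

Lemma alpha_flow_ge0 x d s : 0 <= alpha `|phi s x d|.
Proof. exact: class_K_ge0. Qed.

Lemma tail_integral_le_lyapunov x d t : dist S d -> 0 <= t ->
  (tail_integral S alpha t x d <= (V (phi t x d))%:E)%E.
Proof.
move=> dd t0; have ca := continuous_alpha_flow (x := x) dd.
have a0 (s : R) : 0 <= s -> 0 <= alpha `|phi s x d| by rewrite alpha_flow_ge0.
apply: integral_cy_le => // q tq.
apply: (@le_trans _ _ (V (phi t x d) - V (phi q x d))%:E); last first.
  by rewrite lee_fin gerBl (lyap_ge0 hV).
apply: (@integral_le_dini _ _ ca a0 (fun s => V (phi s x d))); last by rewrite t0.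
- move=> s eta s0.
  exact: (limf_einf_ge0P (lyap_left hV x s0 dd)).
- move=> s eta delta s0 eta0 delta0.
  (* Under the shifted disturbance, the cocycle property turns [Vdot] at the state [phi s x d] into
     the lower right Dini derivative of [V] along the trajectory at time [s]. *)
  have ds := dist_shift dd s0.
  have [h /andP[h0 hd]] := limf_einf_le0P (lyap_decay hV (phi s x d) ds) eta0 delta0.
  rewrite flow_cocycle // ?ltW // -ltr_pdivlMl ?invr_gt0 // invrK => vh.
  by exists h; rewrite ?h0 // ltW.
Qed.

Lemma tail_integral_ge0 x d t : (0 <= tail_integral S alpha t x d)%E.
Proof. by apply: integral_ge0 => s _; rewrite lee_fin alpha_flow_ge0. Qed.

Lemma tail_integral_nonincreasing x d s t : dist S d -> 0 <= s <= t ->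
  (tail_integral S alpha t x d <= tail_integral S alpha s x d)%E.
Proof.
move=> dd /andP[s0 st]; apply: ge0_subset_integral => //.
- apply: measurable_continuous_ge0; first exact: continuous_alpha_flow.
  exact: itv_ge0_sub.
- by move=> u _; rewrite lee_fin alpha_flow_ge0.
- by move=> u /=; rewrite !in_itv /= !andbT; exact: le_trans.
Qed.

Lemma tail_integral_le_psi2 x d t : dist S d -> 0 <= t ->
  (tail_integral S alpha t x d <= (psi2 `|x|)%:E)%E.
Proof.
move=> dd t0; have t00 : (0 : R) <= 0 <= t by rewrite lexx t0.
apply: (le_trans (tail_integral_nonincreasing x dd t00)).
apply: (le_trans (tail_integral_le_lyapunov x dd (lexx 0))).
by rewrite flow_id // lee_fin lyapunov_le.
Qed.

(** By contraposition: a trajectory outside the ball throughout [[p, q[] has integrand at least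
    [alpha delta] there. *)
Lemma visit_small_ball x d p q delta : dist S d -> 0 <= p <= q -> 0 <= delta ->
  (tail_integral S alpha p x d < (alpha delta * (q - p))%:E)%E ->
  exists2 s : R, p <= s < q & `|phi s x d| <= delta.
Proof.
move=> dd /andP[p0 pq] delta0; apply: contraPP => nvisit; apply/negP.
rewrite -leNgt.
have ca := continuous_alpha_flow (x := x) dd.
have a0 (s : R) : 0 <= s -> 0 <= alpha `|phi s x d| by rewrite alpha_flow_ge0.
apply: (@le_trans _ _ (\int[@lebesgue_measure R]_(s in `[p, q[)
    (alpha `|phi s x d|)%:E)%E).
  apply: integral_co_ge => //; first by rewrite p0.
    exact: class_K_ge0.
  move=> s psq; apply: class_K_le => //.
  by rewrite leNgt; apply/negP => /ltW sd; apply: nvisit; exists s.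
apply: ge0_subset_integral => //.
- by apply: measurable_continuous_ge0 => //; exact: itv_ge0_sub.
- by move=> u _; rewrite lee_fin alpha_flow_ge0.
- by move=> u /=; rewrite !in_itv /= andbT => /andP[].
Qed.

(* By time [tau] the trajectory has met a ball on which [psi2 <= eps]; restart
   the integral estimate there. *)
Lemma tail_integral_uniformly_small r eps : 0 < r -> 0 < eps ->
  exists2 tau : R, 0 <= tau & forall x d t, `|x| <= r -> dist S d -> tau <= t ->
    (tail_integral S alpha t x d <= eps%:E)%E.
Proof.
move=> r0 eps0.
have [delta delta0 deltaP] := class_K_small hpsi2 eps0.
have ad := class_K_gt0 halpha delta0.
have pr := class_K_gt0 hpsi2 r0.
(* Then [alpha delta * tau = psi2 r + 1], strictly above the bound [psi2 r] on the whole
   integral. *)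
exists ((psi2 r + 1) / alpha delta); first by rewrite divr_ge0 //; lra.
set tau := _ / _ => x d t xr dd tau_t.
have tau0 : 0 <= tau by rewrite divr_ge0 //; lra.
have [s /andP[s0 st] sd] : exists2 s : R, 0 <= s < tau & `|phi s x d| <= delta.
  apply: visit_small_ball => //; [by rewrite lexx|exact: ltW|].
  apply: (le_lt_trans (tail_integral_le_psi2 x dd (lexx 0))).
  rewrite lte_fin subr0 mulrC divfK ?gt_eqF //.
  by apply: (@le_lt_trans _ _ (psi2 r)); [exact: class_K_le|lra].
have s_t : 0 <= s <= t by lra.
apply: (le_trans (tail_integral_nonincreasing x dd s_t)).
apply: (le_trans (tail_integral_le_lyapunov x dd s0)).
by rewrite lee_fin (le_trans (lyapunov_le _)) // (le_trans _ deltaP) // class_K_le.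
Qed.

Lemma noncoercive_iUGATT : iUGATT S alpha.
Proof.
move=> r r0 A [e /= e0 eA].
(* A supremum only inherits a non-strict bound; [e / 2] keeps it inside the open ball of radius
   [e]. *)
have e2 : 0 < e / 2 by lra.
have [tau tau0 tauP] := tail_integral_uniformly_small r0 e2.
exists tau; split; first exact: num_real.
move=> t tau_t /=; set G := ereal_sup _.
have G0 : (0 <= G)%E by apply: ereal_sup_ubound; left.
have Ge : (G <= (e / 2)%:E)%E.
  apply: ge_ereal_sup => _ [->|[x [d [xr dd ->]]]]; first by rewrite lee_fin ltW.
  apply: tauP => //; last exact: ltW.
  by move: xr; rewrite closed_ballE // /closed_ball_ /= sub0r normrN.
move: G G0 Ge => [g||] //; rewrite !lee_fin => g0 ge.
by apply: eA; rewrite /ball /= sub0r normrN ger0_norm //; lra.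
Qed.

(** The tails are finite, being bounded by [psi2], which serves as the class K majorant; their
    uniform smallness supplies the decay in time. *)
Lemma noncoercive_iUGAS : iUGAS S.
Proof.
pose W r t y := exists x d,
  [/\ dist S d, 0 <= t, r = `|x| & y = fine (tail_integral S alpha t x d)].
have fin x d t : dist S d -> 0 <= t ->
    tail_integral S alpha t x d = (fine (tail_integral S alpha t x d))%:E.
  move=> dd t0; rewrite fineK // ge0_fin_numE ?tail_integral_ge0 //.
  exact: le_lt_trans (tail_integral_le_psi2 x dd t0) (ltry _).
have [||beta Kbeta betaP] := @class_KL_bound _ W psi2 hpsi2.
- move=> _ t _ [x [d [dd t0 -> ->]]]; split=> //.
  by rewrite -!lee_fin -fin // tail_integral_ge0 tail_integral_le_psi2.
- move=> r eps r0 eps0.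
  have [tau tau0 tauP] := tail_integral_uniformly_small r0 eps0.
  exists tau => _ t _ [x [d [dd t0 -> ->]]] xr tau_t.
  by rewrite -lee_fin -fin // tauP.
- exists alpha, beta; split=> // x d t dd t0.
  by rewrite fin // lee_fin; apply: betaP; exists x, d.
Qed.

(* Use robustness of the equilibrium from a time in [[t - 1, t[] at which the
   trajectory is small. *)
Lemma REP_tail_integral eps : REP S -> 0 < eps ->
  exists2 eta : R, 0 < eta & forall x d t, dist S d -> 1 <= t ->
    (tail_integral S alpha (t - 1) x d <= eta%:E)%E -> `|phi t x d| <= eps.
Proof.
move=> [_ rep] eps0; have [delta delta0 deltaP] := rep eps 1 eps0 ltr01.
have ad := class_K_gt0 halpha delta0.
(* Halving makes the tail strictly less than [alpha delta] times the unit length of [[t - 1, t[], as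
   the visit to the [delta]-ball requires. *)
exists (alpha delta / 2); first by lra.
move=> x d t dd t1 tail_t.
have t1t : 0 <= t - 1 <= t by lra.
have [|s /andP[ts st] sd] := visit_small_ball dd t1t (ltW delta0) (x := x).
  by apply: (le_lt_trans tail_t); rewrite lte_fin subKr mulr1; lra.
have s0 : 0 <= s by lra.
have st0 : 0 <= t - s by lra.
have -> : phi t x d = phi (t - s) (phi s x d) (shift_dist s d).
  by rewrite flow_cocycle // addrC subrK.
by apply: deltaP => //; [lra|exact: dist_shift].
Qed.

Lemma REP_UGATT : REP S -> UGATT S.
Proof.
move=> rep r eps r0 eps0.
have [eta eta0 etaP] := REP_tail_integral rep eps0.
have [tau tau0 tauP] := tail_integral_uniformly_small r0 eta0.
(* The tail that controls the state at [t] starts at [t - 1], which must be at least [tau]. *)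
exists (tau + 1); first lra.
move=> x d t xr dd tau_t; apply: etaP => //; first lra.
by apply: tauP => //; lra.
Qed.

(** Robustness of the equilibrium handles [t <= 1]; later, the tail from [t - 1] is at most
    [psi2 |x|], which is small for small [x]. *)
Lemma REP_uniformly_stable eps : REP S -> 0 < eps ->
  exists2 delta : R, 0 < delta & forall x d t, `|x| <= delta -> dist S d ->
    0 <= t -> `|phi t x d| <= eps.
Proof.
move=> rep eps0; have [_ rep1] := rep.
have [eta eta0 etaP] := REP_tail_integral rep eps0.
have [delta1 delta10 delta1P] := rep1 eps 1 eps0 ltr01.
have [delta2 delta20 delta2P] := class_K_small hpsi2 eta0.
exists (Num.min delta1 delta2); first by rewrite lt_min delta10.
move=> x d t; rewrite le_min => /andP[xd1 xd2] dd t0.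
have [t1|/ltW t1] := leP t 1; first by apply: delta1P => //; rewrite t0.
have t10 : 0 <= t - 1 by lra.
apply: etaP => //; apply: (le_trans (tail_integral_le_psi2 x dd t10)).
by rewrite lee_fin (le_trans _ delta2P) // class_K_le.
Qed.

(** The set [Q] of initial states lets one argument serve the local and the global estimate. Uniform
    stability and the boundedness assumption give a class K bound uniform in time, and attractivity
    upgrades it to class KL. *)
Lemma class_KL_estimate (Q : set X) : REP S ->
  (forall C : R, 0 < C -> exists M : R, forall x d t, Q x -> `|x| <= C ->
     dist S d -> 0 <= t -> `|phi t x d| <= M) ->
  exists2 beta, class_KL beta & forall x d t, Q x -> dist S d -> 0 <= t ->
    `|phi t x d| <= beta `|x| t.
Proof.
move=> rep Qbnd.
pose W r t y := exists x d,
  [/\ Q x, dist S d, 0 <= t, r = `|x| & y = `|phi t x d|].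
have [|||sigma Ksigma sigmaP] := @class_K_bound R (fun r y => exists t, W r t y).
- by move=> _ y [t [x [d [_ _ _ -> _]]]].
- move=> eps eps0; have [delta delta0 deltaP] := REP_uniformly_stable rep eps0.
  by exists delta => // _ _ [t [x [d [_ dd t0 -> ->]]]] xd; exact: deltaP.
- move=> C C0; have [M MP] := Qbnd C C0.
  by exists M => _ _ [t [x [d [Qx dd t0 -> ->]]]] xC; exact: MP.
have [||beta Kbeta betaP] := @class_KL_bound _ W sigma Ksigma.
- move=> r t y Wr; have ys : y <= sigma r by apply: sigmaP; exists t.
  by case: Wr ys => x [d [_ _ t0 -> ->]] ->; rewrite !normr_ge0.
- move=> r eps r0 eps0; have [tau _ tauP] := REP_UGATT rep r0 eps0.
  by exists tau => _ t _ [x [d [_ dd _ -> ->]]] xr tau_t; exact: tauP.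
- by exists beta => // x d t Qx dd t0; apply: betaP; exists x, d.
Qed.

Lemma REP_UAS : REP S -> UAS S.
Proof.
move=> rep; have [r r0 rP] := REP_uniformly_stable rep ltr01.
(* On this ball uniform stability already bounds all trajectories by 1. *)
have [|beta Kbeta betaP] := @class_KL_estimate [set x | `|x| <= r] rep.
  by move=> C C0; exists 1 => x d t xr _; exact: rP.
by exists beta => //; exists r.
Qed.

(** Attractivity bounds trajectories by 1 from some time [tau] on; robust forward completeness
    bounds them before. *)
Lemma REP_RFC_UGAS : REP S -> RFC S -> UGAS S.
Proof.
move=> rep rfc.
have [|beta Kbeta betaP] := @class_KL_estimate setT rep; last first.
  by exists beta => // x d t; exact: betaP.
move=> C C0; have [tau tau0 tauP] := REP_UGATT rep C0 ltr01.
(* [RFC] takes a positive horizon, whereas [tau] may be 0. *)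
have tau1 : 0 < tau + 1 by lra.
have := rfc C (tau + 1) C0 tau1; set G := ereal_sup _ => Gy.
exists (Num.max 1 (fine G)) => x d t _ xC dd t0; rewrite le_max.
have [tt|/ltW tt] := leP t tau; last by rewrite tauP.
apply/orP; right.
have phiG : (`|phi t x d|%:E <= G)%E.
  by apply: ereal_sup_ubound; exists t, x, d; split=> //; lra.
(* [G] is finite: [Gy] excludes [+oo] and [phiG] excludes [-oo]. *)
by move: G Gy phiG => [g||].
Qed.

End noncoercive.

Theorem theorem3 (R : realType) (X U : normedModType R)
    (S : forward_complete_system X U) (V : X -> R) (alpha psi2 : R -> R)
    (heq : equilibrium S) (halpha : class_K alpha) (hpsi2 : class_Kinfty psi2)
    (hV : noncoercive_Lyapunov S alpha psi2 V) :
  [/\ iUGS S alpha psi2, iUGATT S alpha & iUGAS S] /\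
  (REP S -> UGATT S /\ UAS S) /\
  (REP S -> RFC S -> UGAS S).
Proof.
have [Kpsi2 _] := hpsi2.
split; last split.
- split.
  + by move=> x d dd; exact: (tail_integral_le_psi2 halpha Kpsi2 hV).
  + exact: (noncoercive_iUGATT halpha Kpsi2 hV).
  + exact: (noncoercive_iUGAS halpha Kpsi2 hV).
- by move=> rep; split; [exact: (REP_UGATT halpha Kpsi2 hV)
    |exact: (REP_UAS halpha Kpsi2 hV)].
- exact: (REP_RFC_UGAS halpha Kpsi2 hV).
Qed.
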